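(* Given $d\ge 2$ and $0<\varepsilon<1$, there exists $\gamma=\Omega\left(\dfrac{\varepsilon^2}{d^{3/2}\log(d)\log^2(d/\varepsilon)}\right)$ such that the following holds for any field $\mathbb{F}$ and any sequence of matrices $M_1,\dots,M_k$ with $M_i\in\mathbb{F}^{d_i\times d_i}$ and $2\le d_i\le d$. Let $M=\bigotimes_{i=1}^kM_i$ and $n=\prod_{i=1}^kd_i$. If $n\ge d^{1/\gamma}$, then $R^{rc}_{\mathbb{F}}(M,n^{1-\gamma})\le n^{\varepsilon}$.
   Context: The row-column rigidity $R^{rc}_{\mathbb{F}}(A,r)$ of $A\in\mathbb{F}^{n\times n}$ is the minimal $t$ for which there exists $Z\in\mathbb{F}^{n\times n}$ with $\operatorname{rank}(A-Z)\le r$ and every row and every column of $Z$ having at most $t$ non-zero entries. $\bigotimes$ is the Kronecker product; $\Omega$ hides an absolute constant. *)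

(* Defs.v *)
From HB Require Import structures.
From mathcomp Require Import all_boot all_order all_algebra.
From mathcomp Require Import mxtens.
From mathcomp Require Import all_classical all_reals all_analysis.

Set Implicit Arguments.
Unset Strict Implicit.
Unset Printing Implicit Defensive.

Import Order.TTheory GRing.Theory Num.Theory.
Local Open Scope ring_scope.

Section RowColumnRigidity.
Context {F : fieldType} {n : nat}.

Definition rc_sparse (t : nat) (Z : 'M[F]_n) : Prop :=
  (forall i, (#|[set j | Z i j != 0%R]%SET| <= t)%N) /\
  (forall j, (#|[set i | Z i j != 0%R]%SET| <= t)%N).

(* The rank bound r may be any nonnegative real, since it is used at
   n ^ (1 - gamma). *)
Definition rc_rigidity_le {R : realType} (A : 'M[F]_n) (r : {nonneg R})
    (t : nat) : Prop :=
  exists Z : 'M[F]_n, (\rank (A - Z)%R)%:R <= r%:num /\ rc_sparse t Z.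

Lemma rc_rigidity_le_ex {R : realType} (A : 'M[F]_n) (r : {nonneg R}) :
  exists t : nat, `[< rc_rigidity_le A r t >].
Proof.
exists n; apply/asboolP; exists A; split; first by rewrite subrr mxrank0 ge0.
by split=> i; rewrite -[X in (_ <= X)%N](card_ord n) max_card.
Qed.

Definition rc_rigidity {R : realType} (A : 'M[F]_n) (r : {nonneg R}) : nat :=
  ex_minn (rc_rigidity_le_ex A r).

End RowColumnRigidity.

(* M_0 (x) (M_1 (x) (... (x) M_(k-1))); the casts only identify the index type
   of tensmx with the unfolding of \prod_(i < k) ds i. *)
Fixpoint bigtensmx {F : fieldType} {k : nat} :
    forall ds : 'I_k -> nat, (forall i, 'M[F]_(ds i)) ->
      'M[F]_(\prod_(i < k) ds i)%N :=
  match k with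
  | 0 => fun ds M =>
      let e := esym (big_ord0 _ _ _ ds) in castmx (e, e) 1%:M
  | k'.+1 => fun ds M =>
      let e := esym (big_ord_recl k' ds) in
      castmx (e, e)
        (tensmx (M ord0) (bigtensmx (fun i : 'I_k' => M (lift ord0 i))))
  end.

(* Main.v *)
Require Import Defs.
From HB Require Import structures.
From mathcomp Require Import all_boot all_order all_algebra.
From mathcomp Require Import perm mxtens ring lra.
From mathcomp Require Import all_classical all_reals all_analysis.

Set Implicit Arguments.
Unset Strict Implicit.
Unset Printing Implicit Defensive.

Import Order.TTheory GRing.Theory Num.Theory.
Local Open Scope ring_scope.

(* By the PLU decomposition every d_i x d_i matrix M_i is a permutation matrix
   times d column-elementary matrices (the identity with column j replaced,
   j < d) times d row-elementary ones, with trivial factors for j >= d_i. The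
   Kronecker product M is then a product of 2 d + 1 Kronecker products of such
   factors, and ranks add while sparsities multiply along this product.

   Fix a level j and let N(x) be the number of coordinates of the multi-index x
   equal to j; its mean is at most k / (j + 1). A nonzero (x, y) entry of the
   Kronecker product of row-elementary matrices of level j can only change
   coordinates of x equal to j, so the Hamming distance of x and y is
   N(x) - N(y). Deleting the rows and columns whose count deviates from the mean
   by more than del_j is a low rank change by Chernoff's inequality, and what is
   left has its support in Hamming balls of radius 2 del_j. Taking del_j
   proportional to 1 / sqrt (j + 1) makes all deviation probabilities equal
   while the total radius only grows like sqrt d. *)

(** * Coordinates of the index type of a Kronecker product *)

(** Prepends a value to a dependent family: the coordinate at position [i] lives in a type depending
    on [i], so the value is transported along the equation supplied by [unliftP]. *)
Definition dcons {k : nat} {T : 'I_k.+1 -> Type} (a : T ord0)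
    (g : forall i, T (lift ord0 i)) (i : 'I_k.+1) : T i :=
  match unliftP ord0 i with
  | UnliftSome j e => ecast i (T i) (esym e) (g j)
  | UnliftNone e => ecast i (T i) (esym e) a
  end.

Lemma dcons0 {k : nat} {T : 'I_k.+1 -> Type} (a : T ord0)
  (g : forall i, T (lift ord0 i)) : dcons a g ord0 = a.
Proof.
rewrite /dcons; case: unliftP => [j e|e]; last by rewrite (eq_axiomK e).
by exfalso; have := neq_lift ord0 j; rewrite -e eqxx.
Qed.

Lemma dconsS {k : nat} {T : 'I_k.+1 -> Type} (a : T ord0)
  (g : forall i, T (lift ord0 i)) (i : 'I_k) : dcons a g (lift ord0 i) = g i.
Proof.
rewrite /dcons; case: unliftP => [j e|e].
  have eji : j = i by apply: (@lift_inj k.+1 ord0).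
  by subst j; rewrite (eq_axiomK e).
by exfalso; have := neq_lift ord0 i; rewrite e eqxx.
Qed.

Lemma ord0_empty : 'I_0 -> False.
Proof. by case. Qed.

(** The mixed-radix digits of a flat index, unfolded with the same casts as [bigtensmx]. *)
Fixpoint tens_coord {k : nat} : forall ds : 'I_k -> nat,
    'I_(\prod_(i < k) ds i)%N -> forall i, 'I_(ds i) :=
  match k with
  | 0 => fun ds _ i => False_rect _ (ord0_empty i)
  | k'.+1 => fun ds x =>
      let p := mxtens_unindex (cast_ord (big_ord_recl k' ds) x) in
      dcons p.1 (tens_coord (ds := fun i => ds (lift ord0 i)) p.2)
  end.

Lemma tens_coord_ord0 (k : nat) (ds : 'I_k.+1 -> nat)
    (x : 'I_(\prod_(i < k.+1) ds i)%N) :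
  tens_coord x ord0 = (mxtens_unindex (cast_ord (big_ord_recl k ds) x)).1.
Proof. exact: dcons0. Qed.

Lemma tens_coord_lift (k : nat) (ds : 'I_k.+1 -> nat)
    (x : 'I_(\prod_(i < k.+1) ds i)%N) (i : 'I_k) :
  tens_coord x (lift ord0 i) =
  tens_coord (ds := fun i => ds (lift ord0 i))
    (mxtens_unindex (cast_ord (big_ord_recl k ds) x)).2 i.
Proof. exact: dconsS. Qed.

Lemma bigtensmxE (F : fieldType) (k : nat) (ds : 'I_k -> nat)
    (M : forall i, 'M[F]_(ds i)) (x y : 'I_(\prod_(i < k) ds i)%N) :
  bigtensmx M x y = \prod_i M i (tens_coord x i) (tens_coord y i).
Proof.
elim: k ds M x y => [|k IH] ds M x y; rewrite [bigtensmx M]/=.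
  rewrite castmxE mxE [RHS]big_ord0.
  by rewrite [cast_ord _ x]ord1 [cast_ord _ y]ord1 eqxx.
rewrite castmxE [_.1]/= [_.2]/= !esymK [LHS]mxE IH [RHS]big_ord_recl !tens_coord_ord0.
by congr (_ * _); apply: eq_bigr => i _; rewrite !tens_coord_lift.
Qed.

(** [tens_coord] identifies flat indices with tuples of coordinates, so this is distributivity. It
    expresses that the coordinates of a uniform index are independent, and factorizes all the
    exponential sums below. *)
Lemma sum_prod_tens_coord (R : comNzRingType) (k : nat) (ds : 'I_k -> nat)
    (f : forall i, 'I_(ds i) -> R) :
  \sum_(x < (\prod_(i < k) ds i)%N) \prod_i f i (tens_coord x i) =
  \prod_i \sum_a f i a.
Proof.
elim: k ds f => [|k IH] ds f.
  rewrite [RHS]big_ord0 (eq_bigr (fun=> 1)) => [|x _]; last by rewrite big_ord0.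
  by rewrite sumr_const card_ord big_ord0.
rewrite [RHS]big_ord_recl -IH mulr_sum.
rewrite (reindex (cast_ord (esym (big_ord_recl k ds)))); last first.
  by exists (cast_ord (big_ord_recl k ds)) => x _; rewrite ?cast_ordK ?cast_ordKV.
apply: eq_bigr => x _; rewrite [LHS]big_ord_recl tens_coord_ord0 cast_ordKV.
by congr (_ * _); apply: eq_bigr => i _; rewrite tens_coord_lift cast_ordKV.
Qed.

Lemma bigtensmx_mul (F : fieldType) (k : nat) (ds : 'I_k -> nat)
    (A B : forall i, 'M[F]_(ds i)) :
  bigtensmx (fun i => A i *m B i) = bigtensmx A *m bigtensmx B.
Proof.
apply/matrixP => x y; rewrite bigtensmxE mxE.
under [RHS]eq_bigr do rewrite !bigtensmxE -big_split /=.
rewrite (sum_prod_tens_coord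
  (fun i z => A i (tens_coord x i) z * B i z (tens_coord y i))).
by apply: eq_bigr => i _; rewrite mxE.
Qed.

Lemma bigtensmx_tr (F : fieldType) (k : nat) (ds : 'I_k -> nat)
    (A : forall i, 'M[F]_(ds i)) :
  bigtensmx (fun i => (A i)^T) = (bigtensmx A)^T.
Proof.
apply/matrixP => x y; rewrite mxE !bigtensmxE.
by apply: eq_bigr => i _; rewrite mxE.
Qed.

Lemma eq_bigtensmx (F : fieldType) (k : nat) (ds : 'I_k -> nat)
    (A B : forall i, 'M[F]_(ds i)) :
  (forall i, A i = B i) -> bigtensmx A = bigtensmx B.
Proof.
move=> AB; apply/matrixP => x y; rewrite !bigtensmxE.
by apply: eq_bigr => i _; rewrite AB.
Qed.

Lemma bigtensmx1 (F : fieldType) (k : nat) (ds : 'I_k -> nat) :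
  bigtensmx (fun i => 1%:M : 'M[F]_(ds i)) = 1%:M.
Proof.
have cast1 m p (e : m = p) : castmx (e, e) 1%:M = 1%:M :> 'M[F]_p.
  by case: _ / e; rewrite castmx_id.
elim: k ds => [|k IH] ds /=; first by rewrite cast1.
rewrite IH.
have -> m p : (1%:M : 'M[F]_m) *t (1%:M : 'M[F]_p) = 1%:M.
  apply/matrixP => x y.
  case: (mxtens_indexP x) => a b; case: (mxtens_indexP y) => a' b'.
  rewrite tensmxE !mxE -natrM mulnb.
  by rewrite (can_eq (@mxtens_indexK _ _)) xpair_eqE.
by rewrite cast1.
Qed.

Lemma bigtensmx_prod (F : fieldType) (k : nat) (ds : 'I_k -> nat)
    (A : forall i, nat -> 'M[F]_(ds i)) (s : seq nat) :
  bigtensmx (fun i => \big[mulmx/1%:M]_(j <- s) A i j) =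
  \big[mulmx/1%:M]_(j <- s) bigtensmx (fun i => A i j).
Proof.
elim: s => [|j s IH].
  by rewrite big_nil -bigtensmx1; apply: eq_bigtensmx => i; rewrite big_nil.
rewrite big_cons -IH -bigtensmx_mul.
by apply: eq_bigtensmx => i; rewrite big_cons.
Qed.

(** * Factorization of a square matrix *)

(** Only the support is constrained: the diagonal is arbitrary, and for [j >= n] the matrix is just
    diagonal. *)
Definition row_elementary (F : fieldType) (n j : nat) (A : 'M[F]_n) : Prop :=
  forall x y : 'I_n, A x y != 0 -> x = y \/ x = j :> nat.

(** Take for [A j] the identity with row [j] replaced by that of [U]. Multiplying by [A m] on the
    left installs row [m] of [U]: this row is supported on columns from [m] on, and there the
    partial product still has the rows of the identity. Factors with [j >= n] are the identity, so
    one [D] can serve matrices of different sizes. *)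
Lemma upper_triangular_factor (F : fieldType) (n : nat) (U : 'M[F]_n) :
  (forall x y : 'I_n, (y < x)%N -> U x y = 0) ->
  exists2 A : nat -> 'M[F]_n, (forall j, row_elementary j (A j)) &
    forall D, (n <= D)%N -> U = \big[mulmx/1%:M]_(j <- rev (iota 0 D)) A j.
Proof.
move=> upU.
pose A j : 'M[F]_n := \matrix_(x, y) if x == j :> nat then U x y else (x == y)%:R.
have prodA m : \big[mulmx/1%:M]_(j <- rev (iota 0 m)) A j =
    \matrix_(x, y) if (x < m)%N then U x y else (x == y)%:R.
  elim: m => [|m IH]; first by rewrite big_nil; apply/matrixP => x y; rewrite !mxE.
  rewrite -addn1 iotaD rev_cat big_cons add0n IH; apply/matrixP => x y.
  rewrite !mxE addn1 ltnS.
  under eq_bigr do rewrite !mxE.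
  have [xm|xm] := eqVneq (x : nat) m; last first.
    rewrite (bigD1 x) //= eqxx mul1r big1 ?addr0 => [|z /negPf zx].
      by rewrite [(x <= m)%N]leq_eqVlt (negPf xm).
    by rewrite eq_sym zx mul0r.
  rewrite xm leqnn (bigD1 y) //= big1 ?addr0 => [|z /negPf zy].
    case: ltnP => ym; last by rewrite eqxx mulr1.
    by rewrite upU ?xm // mul0r.
  case: ltnP => zm; first by rewrite upU ?xm // mul0r.
  by rewrite zy mulr0.
exists A => [j x y|D nD].
  rewrite mxE; case: (eqVneq (x : nat) j) => [->|_]; first by right.
  by case: (eqVneq x y) => [->|_]; [left | rewrite eqxx].
rewrite prodA; apply/matrixP => x y.
by rewrite mxE (leq_trans (ltn_ord x) nD).
Qed.

Lemma trmx_prod (F : fieldType) (n : nat) (A : nat -> 'M[F]_n) (s : seq nat) :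
  (\big[mulmx/1%:M]_(j <- s) A j)^T = \big[mulmx/1%:M]_(j <- rev s) (A j)^T.
Proof.
elim: s => [|j s IH]; first by rewrite !big_nil trmx1.
rewrite big_cons trmx_mul IH rev_cons -cats1.
by rewrite -[RHS]/(\prod_(i <- rev s ++ [:: j]) (A i)^T) big_cat big_seq1.
Qed.

(** This is the LUP decomposition. The lower factor is treated through its transpose, so that only
    row-elementary matrices need analysis. *)
Lemma mx_elementary_factor (F : fieldType) (n : nat) (M : 'M[F]_n) :
  exists s : 'S_n, exists A B : nat -> 'M[F]_n,
  [/\ forall j, row_elementary j (A j), forall j, row_elementary j (B j) &
   forall D, (n <= D)%N ->
     M = perm_mx s *m (\big[mulmx/1%:M]_(j <- iota 0 D) (A j)^T *m
                       \big[mulmx/1%:M]_(j <- rev (iota 0 D)) B j)].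
Proof.
case: n M => [|n] M.
  exists 1%g, (fun=> 0), (fun=> 0); split=> [j []//|j []//|D _].
  by apply/matrixP => -[].
have := cormen_lup_correct M; have := cormen_lup_perm M.
have := @cormen_lup_lower _ _ M; have := @cormen_lup_upper _ _ M.
case: (cormen_lup M) => [[P L] U] /= upU loL /is_perm_mxP[s ->] PM.
have [B eB UB] := upper_triangular_factor upU.
have [x y yx|A eA LA] := @upper_triangular_factor _ _ L^T.
  by rewrite mxE loL 1?ltnW // -val_eqE ltn_eqF.
exists (s^-1)%g, A, B; split => // D nD.
rewrite -(UB D nD) -[iota 0 D]revK -trmx_prod -(LA D nD) trmxK.
have -> : L *m U = perm_mx s *m M by rewrite !mulmxE PM.
by rewrite mulmxA -perm_mxM mulVg perm_mx1 mul1mx.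
Qed.

(** * Low rank plus sparse approximations *)

(** A rigidity upper bound with real parameters; counting by sums of indicators lets exponential
    moment bounds apply directly. *)
Definition rc_approx (R : realType) (F : fieldType) (n : nat) (r t : R)
    (A : 'M[F]_n) : Prop :=
  exists Z : 'M[F]_n,
    [/\ (\rank (A - Z))%:R <= r,
        forall x, \sum_y (Z x y != 0)%:R <= t &
        forall y, \sum_x (Z x y != 0)%:R <= t].

Lemma rc_approx_le (R : realType) (F : fieldType) (n : nat) (r t r' t' : R)
    (A : 'M[F]_n) :
  rc_approx r t A -> r <= r' -> t <= t' -> rc_approx r' t' A.
Proof.
move=> [Z [rZ tZ tZ']] rr tt; exists Z; split => [|x|y].
- exact: le_trans rr.
- exact: le_trans (tZ x) tt.
- exact: le_trans (tZ' y) tt.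
Qed.

Lemma rc_approx_tr (R : realType) (F : fieldType) (n : nat) (r t : R)
    (A : 'M[F]_n) : rc_approx r t A -> rc_approx r t A^T.
Proof.
move=> [Z [rZ tZ tZ']]; exists Z^T; split => [|x|y].
- by rewrite -linearB /= mxrank_tr.
- by under eq_bigr do rewrite mxE.
- by under eq_bigr do rewrite mxE.
Qed.

(** A nonzero entry [(x, y)] of the product forces some [z] with [Z1 x z] and [Z2 z y] both nonzero;
    summing over these two-step paths bounds the count. *)
Lemma sum_mulmx_neq0_le (R : realType) (F : fieldType) (n : nat) (t1 t2 : R)
    (Z1 Z2 : 'M[F]_n) (x : 'I_n) :
  0 <= t2 -> \sum_z (Z1 x z != 0)%:R <= t1 ->
  (forall z, \sum_y (Z2 z y != 0)%:R <= t2) ->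
  \sum_y ((Z1 *m Z2) x y != 0)%:R <= t1 * t2.
Proof.
move=> t2_ge0 h1 h2.
apply: (@le_trans _ _ (\sum_y \sum_z (Z1 x z != 0)%:R * (Z2 z y != 0)%:R)).
  apply: ler_sum => y _; rewrite mxE.
  case: eqP => [_|/eqP nz]; first by apply: sumr_ge0 => z _; rewrite mulr_ge0.
  have [z nzz] : exists z, Z1 x z * Z2 z y != 0.
    apply/existsP; apply: contra_neqT nz => /existsPn all0.
    by apply: big1 => z _; apply/eqP; have := all0 z; rewrite negbK.
  rewrite (bigD1 z) //=; move: nzz; rewrite mulf_eq0 negb_or => /andP[-> ->].
  by rewrite mulr1 lerDl; apply: sumr_ge0 => w _; rewrite mulr_ge0.
rewrite exchange_big /=.
apply: le_trans (ler_wpM2r t2_ge0 h1); rewrite mulr_suml; apply: ler_sum => z _.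
by rewrite -mulr_sumr ler_wpM2l.
Qed.

Lemma rc_approx_mul (R : realType) (F : fieldType) (n : nat) (r1 t1 r2 t2 : R)
    (A1 A2 : 'M[F]_n) :
  0 <= t1 -> 0 <= t2 ->
  rc_approx r1 t1 A1 -> rc_approx r2 t2 A2 ->
  rc_approx (r1 + r2) (t1 * t2) (A1 *m A2).
Proof.
move=> t1_ge0 t2_ge0 [Z1 [r1Z rZ1 cZ1]] [Z2 [r2Z rZ2 cZ2]].
exists (Z1 *m Z2); split => [|x|y].
- have -> : A1 *m A2 - Z1 *m Z2 = (A1 - Z1) *m Z2 + A1 *m (A2 - Z2).
    by rewrite mulmxBl mulmxBr [RHS]addrC addrA subrK.
  apply: le_trans (lerD r1Z r2Z); rewrite -natrD ler_nat.
  apply: leq_trans (mxrank_add _ _) _.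
  by apply: leq_add; [exact: mxrankM_maxl | exact: mxrankM_maxr].
- exact: sum_mulmx_neq0_le.
(* Columns of the product are rows of [Z2^T *m Z1^T]. *)
- have := @sum_mulmx_neq0_le R F n t2 t1 Z2^T Z1^T y t1_ge0.
  rewrite -trmx_mul mulrC.
  under [in X in _ -> _ -> X]eq_bigr do rewrite mxE; apply.
    by under eq_bigr do rewrite mxE.
  by move=> z; under eq_bigr do rewrite mxE.
Qed.

Lemma rc_approx_sparse (R : realType) (F : fieldType) (n : nat) (t : R)
    (A : 'M[F]_n) :
  (forall x, \sum_y (A x y != 0)%:R <= t) ->
  (forall y, \sum_x (A x y != 0)%:R <= t) -> rc_approx 0 t A.
Proof. by move=> h1 h2; exists A; rewrite subrr mxrank0. Qed.

Lemma sum_delta (R : realType) (n : nat) (x : 'I_n) :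
  \sum_y (x == y)%:R = 1 :> R.
Proof.
by rewrite (bigD1 x) //= eqxx big1 ?addr0 // => y; rewrite eq_sym => /negPf ->.
Qed.

Lemma rc_approx_prod (R : realType) (F : fieldType) (n : nat)
    (r t : nat -> R) (A : nat -> 'M[F]_n) (s : seq nat) :
  (forall j, j \in s -> 0 <= t j) ->
  (forall j, j \in s -> rc_approx (r j) (t j) (A j)) ->
  rc_approx (\sum_(j <- s) r j) (\prod_(j <- s) t j)
            (\big[mulmx/1%:M]_(j <- s) A j).
Proof.
elim: s => [|j s IH] t0 app.
  have nz (x y : 'I_n) : ((1%:M : 'M[F]_n) x y != 0) = (x == y).
    by rewrite mxE; case: (x =P y) => _; rewrite ?mulr1n ?mulr0n ?oner_eq0 ?eqxx.
  rewrite !big_nil; apply: rc_approx_sparse => [x|y].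
    by under eq_bigr do rewrite nz; rewrite sum_delta.
  under eq_bigr do rewrite nz eq_sym.
  by rewrite sum_delta.
rewrite !big_cons; apply: rc_approx_mul; first exact/t0/mem_head.
- rewrite big_seq prodr_ge0 // => i si; apply: t0.
  by rewrite in_cons si orbT.
- exact/app/mem_head.
- by apply: IH => i si; [apply: t0|apply: app]; rewrite in_cons si orbT.
Qed.

(** * Concentration of coordinate counts *)

(** Multiply by [1 - t > 0]: the left side becomes at most 1 because [1 - t <= expR (- t)], and the
    right side becomes [1 + t^2 (1 - 2 t) >= 1]. *)
Lemma expR_le_quadratic (R : realType) (t : R) :
  t <= 2^-1 -> expR t <= 1 + t + 2 * t ^+ 2.
Proof.
move=> t_le; have t1 : 0 < 1 - t by lra.
rewrite -(ler_pM2r t1); apply: (@le_trans _ _ 1).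
  apply: le_trans (ler_wpM2l (expR_ge0 t) (expR_ge1Dx (- t))) _.
  by rewrite expRxMexpNx_1.
have -> : (1 + t + 2 * t ^+ 2) * (1 - t) = 1 + t ^+ 2 * (1 - 2 * t) by ring.
by rewrite lerDl mulr_ge0 ?sqr_ge0 //; lra.
Qed.

Lemma sum_ord_eq (R : realType) (m j : nat) :
  \sum_(a < m) (a == j :> nat)%:R = (j < m)%N%:R :> R.
Proof.
case: ltnP => [jm|mj].
  rewrite (bigD1 (Ordinal jm)) //= eqxx big1 ?addr0 // => a.
  by rewrite -val_eqE /= => /negPf ->.
by rewrite big1 // => a _; rewrite ltn_eqF // (leq_trans (ltn_ord a)).
Qed.

(** Moment generating function, scaled by [m], of a centred Bernoulli variable of parameter [p]: use
    [1 + p (e^t - 1) <= exp (p (e^t - 1))], then the quadratic bound on [e^t]. Negative [t] is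
    allowed, for the lower tail. *)
Lemma sum_expR_indicator_le (R : realType) (m j : nat) (t : R) :
  (0 < m)%N -> t <= 2^-1 ->
  \sum_(a < m) expR (t * ((a == j :> nat)%:R - (j < m)%N%:R / m%:R)) <=
  m%:R * expR (2 * t ^+ 2 * ((j < m)%N%:R / m%:R)).
Proof.
move=> m_gt0 t_le; set p := (j < m)%N%:R / m%:R.
have p_ge0 : 0 <= p by rewrite divr_ge0.
have m_neq0 : m%:R != 0 :> R by rewrite pnatr_eq0 -lt0n.
have -> : \sum_(a < m) expR (t * ((a == j :> nat)%:R - p)) =
    m%:R * ((1 + p * (expR t - 1)) * expR (- (t * p))).
  transitivity (\sum_(a < m)
      (1 + (a == j :> nat)%:R * (expR t - 1)) * expR (- (t * p))).
    apply: eq_bigr => a _; rewrite mulrBr expRD; congr (_ * _).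
    by case: eqP => _; rewrite ?mulr1 ?mulr0 ?mul1r ?mul0r ?expR0; ring.
  rewrite -mulr_suml big_split /= sumr_const card_ord -mulr_suml sum_ord_eq.
  by rewrite mulrA /p; congr (_ * _); field.
rewrite ler_wpM2l //.
apply: (@le_trans _ _ (expR (p * (expR t - 1)) * expR (- (t * p)))).
  by rewrite ler_wpM2r ?expR_ge0 // expR_ge1Dx.
rewrite -expRD ler_expR.
have := expR_le_quadratic t_le; rewrite -subr_ge0 => h.
rewrite -subr_ge0.
have -> : 2 * t ^+ 2 * p - (p * (expR t - 1) - t * p) =
          p * (1 + t + 2 * t ^+ 2 - expR t) by ring.
exact: mulr_ge0.
Qed.

Definition coord_count (R : realType) (k : nat) (ds : 'I_k -> nat) (j : nat)
    (x : 'I_(\prod_(i < k) ds i)%N) : R :=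
  \sum_i (tens_coord x i == j :> nat)%:R.

(** The expectation of [coord_count] at a uniform index: coordinate [i] equals [j] with probability
    [1 / ds i] if [j < ds i], and never otherwise. *)
Definition coord_mean (R : realType) (k : nat) (ds : 'I_k -> nat) (j : nat) : R :=
  \sum_i (j < ds i)%N%:R / (ds i)%:R.

Lemma coord_mean_le (R : realType) (k : nat) (ds : 'I_k -> nat) (j : nat) :
  coord_mean R ds j <= k%:R / j.+1%:R.
Proof.
apply: (@le_trans _ _ (\sum_(i < k) j.+1%:R^-1)).
  apply: ler_sum => i _; case: ltnP => [jd|_]; last by rewrite mul0r invr_ge0.
  by rewrite mul1r lef_pV2 ?posrE ?ltr0n ?ler_nat // (leq_ltn_trans _ jd).
by rewrite sumr_const card_ord mulrC mulr_natr.
Qed.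

Lemma sum_expR_coord_count_le (R : realType) (k : nat) (ds : 'I_k -> nat)
    (j : nat) (t : R) :
  (forall i, (0 < ds i)%N) -> t <= 2^-1 ->
  \sum_(x < (\prod_(i < k) ds i)%N)
    expR (t * (coord_count R j x - coord_mean R ds j)) <=
  (\prod_(i < k) ds i)%N%:R * expR (2 * t ^+ 2 * coord_mean R ds j).
Proof.
move=> ds_gt0 t_le.
pose f i (a : 'I_(ds i)) : R :=
  expR (t * ((a == j :> nat)%:R - (j < ds i)%N%:R / (ds i)%:R)).
rewrite (eq_bigr (fun x => \prod_i f i (tens_coord x i))); last first.
  move=> x _; rewrite -expR_sum -mulr_sumr sumrB.
  by [].
rewrite sum_prod_tens_coord natr_prod /coord_mean mulr_sumr expR_sum -big_split /=.
apply: ler_prod => i _; rewrite sum_expR_indicator_le // andbT.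
by apply: sumr_ge0 => a _; exact: expR_ge0.
Qed.

(** Two-sided Chernoff bound: with [z] the deviation, the indicator of [del < |z|] is at most
    [exp (t z - t del) + exp (- t z - t del)]. *)
Lemma atypical_count_le (R : realType) (k : nat) (ds : 'I_k -> nat)
    (j : nat) (t del : R) :
  (forall i, (0 < ds i)%N) -> 0 <= t -> t <= 2^-1 ->
  \sum_(x < (\prod_(i < k) ds i)%N)
    (del < `|coord_count R j x - coord_mean R ds j|)%R%:R <=
  2 * (\prod_(i < k) ds i)%N%:R * expR (2 * t ^+ 2 * coord_mean R ds j - t * del).
Proof.
move=> ds_gt0 t_ge0 t_le.
have bound s : s <= 2^-1 -> s ^+ 2 = t ^+ 2 ->
    \sum_(x < (\prod_(i < k) ds i)%N)
    expR (s * (coord_count R j x - coord_mean R ds j) - t * del) <=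
    (\prod_(i < k) ds i)%N%:R * expR (2 * t ^+ 2 * coord_mean R ds j - t * del).
  move=> s_le st; rewrite expRD mulrA -st.
  under eq_bigr do rewrite expRD.
  by rewrite -mulr_suml ler_wpM2r ?expR_ge0 // sum_expR_coord_count_le.
have bp := bound t t_le erefl.
have bn : _ := bound (- t) _ (sqrrN t).
rewrite -mulrA mulr2n mulrDl !mul1r.
apply: le_trans (lerD bp (bn _)); last by lra.
rewrite -big_split /=; apply: ler_sum => x _.
set z := coord_count R j x - _.
case: ltP => [dz|_]; last by rewrite addr_ge0 ?expR_ge0.
have [z0|z0] := leP 0 z.
  rewrite ger0_norm // in dz; rewrite ler_wpDr ?expR_ge0 //.
  rewrite -[X in X <= _]expR0 ler_expR -mulrBr mulr_ge0 // subr_ge0; exact: ltW.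
rewrite ltr0_norm // in dz; rewrite ler_wpDl ?expR_ge0 //.
rewrite -[X in X <= _]expR0 ler_expR mulNr -mulrN -mulrBr mulr_ge0 // subr_ge0.
exact: ltW.
Qed.

(** The indicator of distance at most [Del] is bounded by [exp (l (Del - distance))], whose sum
    factorizes; each coordinate contributes at most [1 + d e^(-l) <= exp (d e^(-l))]. *)
Lemma hamming_ball_le (R : realType) (k d : nat) (ds : 'I_k -> nat)
    (l Del : R) (x : 'I_(\prod_(i < k) ds i)%N) :
  (forall i, (ds i <= d)%N) -> 0 <= l ->
  \sum_(y < (\prod_(i < k) ds i)%N)
    (\sum_i (tens_coord x i != tens_coord y i)%:R <= Del)%R%:R <=
  expR (Del * l + k%:R * (d%:R * expR (- l))).
Proof.
move=> ds_le l_ge0.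
pose f i (a : 'I_(ds i)) : R := expR (- l * (tens_coord x i != a)%:R).
apply: (@le_trans _ _ (\sum_(y < (\prod_(i < k) ds i)%N)
    expR (Del * l) * \prod_i f i (tens_coord y i))).
  apply: ler_sum => y _; rewrite -expR_sum -expRD -mulr_sumr.
  case: (leP _ Del) => [le_Del|_]; last exact: expR_ge0.
  rewrite -[X in X <= _]expR0 ler_expR mulrC mulNr -mulrBr.
  by rewrite mulr_ge0 // subr_ge0.
rewrite -mulr_sumr sum_prod_tens_coord expRD ler_wpM2l ?expR_ge0 //.
have -> : k%:R * (d%:R * expR (- l)) = \sum_(i < k) d%:R * expR (- l).
  by rewrite sumr_const card_ord mulr_natl.
rewrite expR_sum; apply: ler_prod => i _; apply/andP; split.
  by apply: sumr_ge0 => a _; exact: expR_ge0.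
apply: le_trans (expR_ge1Dx _).
apply: (@le_trans _ _ (\sum_(a < ds i) ((tens_coord x i == a)%:R + expR (- l)))).
  apply: ler_sum => a _; rewrite /f; case: eqP => _ /=.
    by rewrite mulr0 expR0 lerDl expR_ge0.
  by rewrite mulr1 add0r.
rewrite big_split /= sum_delta lerD2l sumr_const card_ord -[X in X <= _]mulr_natl.
by rewrite ler_wpM2r ?expR_ge0 // ler_nat.
Qed.

(** * Kronecker products of elementary matrices *)

Lemma rank_diag_le (F : fieldType) (n : nat) (T : pred 'I_n) :
  (\rank (diag_mx (\row_x (T x)%:R : 'rV[F]_n)) <= \sum_x T x)%N.
Proof.
have -> : diag_mx (\row_x (T x)%:R : 'rV[F]_n) =
    \sum_x (T x)%:R *: delta_mx x x.
  rewrite diag_mx_sum_delta; apply: eq_bigr => x _.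
  by rewrite mxE.
elim/big_ind2: _ => [|A a B b rA rB|x _]; first by rewrite mxrank0.
  exact: leq_trans (mxrank_add _ _) (leq_add rA rB).
case: (T x); last by rewrite scale0r mxrank0.
by rewrite scale1r mxrank_delta.
Qed.

Lemma rc_approx_bigtensmx_row (R : realType) (F : fieldType) (k d : nat)
    (ds : 'I_k -> nat) (j : nat) (A : forall i, 'M[F]_(ds i)) (t del l : R) :
  (forall i, (0 < ds i <= d)%N) -> (forall i, row_elementary j (A i)) ->
  0 <= t -> t <= 2^-1 -> 0 <= l ->
  rc_approx
    (4 * (\prod_(i < k) ds i)%N%:R *
       expR (2 * t ^+ 2 * coord_mean R ds j - t * del))
    (expR (2 * del * l + k%:R * (d%:R * expR (- l))))
    (bigtensmx A).
Proof.
move=> ds_bd elA t_ge0 t_le l_ge0.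
have ds_gt0 i : (0 < ds i)%N by case/andP: (ds_bd i).
have ds_le i : (ds i <= d)%N by case/andP: (ds_bd i).
set B := bigtensmx A.
pose T (x : 'I_(\prod_(i < k) ds i)%N) :=
  del < `|coord_count R j x - coord_mean R ds j|.
pose D := diag_mx (\row_x (T x)%:R : 'rV[F]_(\prod_(i < k) ds i)).
pose E := diag_mx (\row_x (~~ T x)%:R : 'rV[F]_(\prod_(i < k) ds i)).
(* [Z] keeps the entries of [B] whose row and column are both typical. *)
pose Z := E *m B *m E.
have ED : E + D = 1%:M.
  apply/matrixP => x y; rewrite !mxE -mulrnDl.
  by case: (T x); rewrite ?addr0 ?add0r.
have ZE x y : Z x y = (~~ T x)%:R * B x y * (~~ T y)%:R.
  by rewrite /Z mul_mx_diag mxE mul_diag_mx !mxE.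
(* A nonzero entry of B can only change coordinates equal to j, and each such
   change lowers the count by one. *)
have dist x y : Z x y != 0 ->
    \sum_i (tens_coord x i != tens_coord y i)%:R <= 2 * del :> R.
  rewrite ZE.
  case Tx: (T x); first by rewrite !mul0r eqxx.
  case Ty: (T y); first by rewrite mulr0 eqxx.
  rewrite mul1r mulr1 /B bigtensmxE => /prodf_neq0 nz.
  have -> : \sum_i (tens_coord x i != tens_coord y i)%:R =
      coord_count R j x - coord_count R j y.
    rewrite -sumrB; apply: eq_bigr => i _.
    have [->|xy] := eqVneq (tens_coord x i) (tens_coord y i).
      by rewrite subrr.
    case: (elA i _ _ (nz i isT)) => [/eqP|xj]; first by rewrite (negPf xy).
    by rewrite xj eqxx -xj eq_sym val_eqE (negPf xy) subr0.
  have : `|coord_count R j x - coord_mean R ds j| <= del by rewrite leNgt -/(T x) Tx.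
  have : `|coord_count R j y - coord_mean R ds j| <= del by rewrite leNgt -/(T y) Ty.
  rewrite !ler_norml => /andP[h1 h2] /andP[h3 h4]; lra.
have ind_le (b : bool) (P : bool) : (b -> P) -> b%:R <= P%:R :> R.
  by case: b P => [] [] // /(_ isT).
exists Z; split => [|x|y].
(* Each summand has rank at most the number of atypical indices; with the two tails of the Chernoff
   bound this gives the constant 4. *)
- have -> : B - Z = D *m B + E *m B *m D.
    have -> : D = 1%:M - E by rewrite -ED addrAC subrr add0r.
    by rewrite mulmxBl mulmxBr mul1mx mulmx1 addrA subrK.
  apply: (@le_trans _ _ (2 * \sum_x (T x)%:R)).
    rewrite -natr_sum -natrM ler_nat mul2n -addnn.
    apply: leq_trans (mxrank_add _ _) (leq_add _ _).
      exact: leq_trans (mxrankM_maxl _ _) (rank_diag_le _ _).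
    exact: leq_trans (mxrankM_maxr _ _) (rank_diag_le _ _).
  have -> (a e : R) : 4 * a * e = 2 * (2 * a * e) by ring.
  by rewrite ler_pM2l // atypical_count_le.
- apply: le_trans (hamming_ball_le _ x ds_le l_ge0).
  by apply: ler_sum => y _; apply: ind_le; exact: dist.
- apply: le_trans (hamming_ball_le _ y ds_le l_ge0).
  apply: ler_sum => x _; apply: ind_le => /dist.
  by under eq_bigr do rewrite eq_sym.
Qed.

Lemma sum_bigtensmx_neq0 (R : realType) (F : fieldType) (k : nat)
    (ds : 'I_k -> nat) (A : forall i, 'M[F]_(ds i))
    (x : 'I_(\prod_(i < k) ds i)%N) :
  \sum_y (bigtensmx A x y != 0)%:R =
  \prod_i \sum_a (A i (tens_coord x i) a != 0)%:R :> R.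
Proof.
rewrite -sum_prod_tens_coord; apply: eq_bigr => y _; rewrite bigtensmxE.
rewrite (big_morph (fun z : F => (z != 0)%:R : R) (id1 := 1) (op1 := *%R)) //.
  by move=> a b; rewrite mulf_eq0 negb_or -mulnb natrM.
by rewrite oner_neq0.
Qed.

Lemma rc_approx_bigtensmx_perm (R : realType) (F : fieldType) (k : nat)
    (ds : 'I_k -> nat) (s : forall i, 'S_(ds i)) :
  rc_approx (0 : R) 1 (bigtensmx (fun i => perm_mx (s i) : 'M[F]_(ds i))).
Proof.
have row_sum (u : forall i, 'S_(ds i)) x :
    \sum_y (bigtensmx (fun i => perm_mx (u i) : 'M[F]_(ds i)) x y != 0)%:R = 1 :> R.
  rewrite sum_bigtensmx_neq0 big1 // => i _.
  rewrite -[RHS](sum_delta R (u i (tens_coord x i))); apply: eq_bigr => a _.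
  by rewrite !mxE; case: (_ =P a) => _; rewrite ?mulr1n ?mulr0n ?oner_eq0 ?eqxx.
apply: rc_approx_sparse => [x|y]; first by rewrite row_sum.
(* Columns for [s] are rows for the inverse permutations. *)
rewrite (eq_bigr (fun x =>
  (bigtensmx (fun i => perm_mx (s i)^-1 : 'M[F]_(ds i)) y x != 0)%:R)).
  by rewrite row_sum.
move=> x _; rewrite !bigtensmxE.
by under eq_bigr do rewrite -[s _]invgK -tr_perm_mx mxE.
Qed.

(** The induction step is [1 / sqrt (d + 1) <= 2 (sqrt (d + 1) - sqrt d)], which reduces to
    [(s - t)^2 >= 0] for the two roots [s] and [t]. *)
Lemma sum_invsqrt_le (R : realType) (d : nat) :
  \sum_(j <- iota 0 d) (Num.sqrt j.+1%:R)^-1 <= 2 * Num.sqrt d%:R :> R.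
Proof.
elim: d => [|d IH]; first by rewrite big_nil mulr_ge0 ?sqrtr_ge0.
rewrite -addn1 iotaD big_cat big_seq1 add0n addn1.
apply: le_trans (lerD IH (lexx _)) _.
have s0 : 0 <= Num.sqrt d%:R :> R by exact: sqrtr_ge0.
have t0 : 0 < Num.sqrt d.+1%:R :> R by rewrite sqrtr_gt0.
have sq0 : Num.sqrt d%:R ^+ 2 = d%:R :> R by rewrite sqr_sqrtr.
have sq1 : Num.sqrt d.+1%:R ^+ 2 = d%:R + 1 :> R by rewrite sqr_sqrtr // natr1.
move: (Num.sqrt d%:R) (Num.sqrt d.+1%:R) s0 t0 sq0 sq1 => s t s0 t0 sq0 sq1.
rewrite -(ler_pM2r t0) mulrDl mulVf ?gt_eqF //.
have : (s - t) ^+ 2 >= 0 by exact: sqr_ge0.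
nra.
Qed.

(** The [2 d] level factors, each of rank error [4 n exp (- b^2 k)], account for [8 d]; the
    permutation factor costs nothing. Sparsity exponents add up, and the sum of the radii is where
    [sqrt d] enters. *)
Lemma rc_approx_bigtensmx (R : realType) (F : fieldType) (k d : nat)
    (ds : 'I_k -> nat) (M : forall i, 'M[F]_(ds i)) (b l : R) :
  (forall i, (0 < ds i <= d)%N) -> 0 < b -> b * Num.sqrt d%:R <= 2^-1 -> 0 <= l ->
  rc_approx
    (8 * d%:R * (\prod_(i < k) ds i)%N%:R * expR (- (b ^+ 2 * k%:R)))
    (expR (2 * (12 * b * k%:R * Num.sqrt d%:R * l +
                k%:R * d%:R ^+ 2 * expR (- l))))
    (bigtensmx M).
Proof.
move=> ds_bd b_gt0 b_le l_ge0.
pose w1 i := cid (mx_elementary_factor (M i)).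
pose w2 i := cid (proj2_sig (w1 i)); pose w3 i := cid (proj2_sig (w2 i)).
pose s i := sval (w1 i); pose A i := sval (w2 i); pose B i := sval (w3 i).
have elA j i : row_elementary j (A i j) by case: (proj2_sig (w3 i)) => + _ _; apply.
have elB j i : row_elementary j (B i j) by case: (proj2_sig (w3 i)) => _ + _; apply.
have MAB i : M i = perm_mx (s i) *m (\big[mulmx/1%:M]_(j <- iota 0 d) (A i j)^T *m
    \big[mulmx/1%:M]_(j <- rev (iota 0 d)) B i j).
  by case: (proj2_sig (w3 i)) => _ _; apply; case/andP: (ds_bd i).
rewrite (eq_bigtensmx MAB) bigtensmx_mul bigtensmx_mul !bigtensmx_prod.
set n := (\prod_(i < k) ds i)%N.
pose r : R := 4 * n%:R * expR (- (b ^+ 2 * k%:R)).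
(* With Chernoff parameter [b sqrt (j + 1)], the variance term is at most [2 b^2 k] and the
   deviation term is [3 b^2 k], so every level has exponent at most [- b^2 k]. *)
pose del j : R := 3 * b * k%:R / Num.sqrt j.+1%:R.
pose t j := expR (2 * del j * l + k%:R * (d%:R * expR (- l))).
have level (C : forall i, nat -> 'M[F]_(ds i)) j :
    (forall i, row_elementary j (C i j)) -> (j < d)%N ->
    rc_approx r (t j) (bigtensmx (fun i => C i j)).
  move=> elC jd.
  have sj0 : 0 < Num.sqrt j.+1%:R :> R by rewrite sqrtr_gt0.
  apply: rc_approx_le (@rc_approx_bigtensmx_row R F k d ds j _
    (b * Num.sqrt j.+1%:R) (del j) l ds_bd elC _ _ l_ge0) _ (lexx _).
  - by rewrite mulr_ge0 // ltW.
  - apply: le_trans b_le; rewrite ler_pM2l // ler_sqrt ?ler_nat //.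
  rewrite ler_wpM2l // ?mulr_ge0 // ler_expR.
  have tdel : b * Num.sqrt j.+1%:R * del j = 3 * b ^+ 2 * k%:R.
    by rewrite /del; field; rewrite gt_eqF.
  rewrite tdel exprMn sqr_sqrtr //.
  have : 2 * (b ^+ 2 * j.+1%:R) * coord_mean R ds j <= 2 * b ^+ 2 * k%:R.
    have -> : 2 * b ^+ 2 * k%:R = 2 * (b ^+ 2 * j.+1%:R) * (k%:R / j.+1%:R).
      have : 0 < j.+1%:R :> R by [].
      by move: (j.+1%:R : R) => z z_gt0; field; rewrite gt_eqF.
    apply: ler_wpM2l (coord_mean_le R ds j).
    by rewrite mulr_ge0 // mulr_ge0 ?sqr_ge0.
  lra.
have in_iota j : j \in iota 0 d -> (j < d)%N by rewrite mem_iota.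
have prod_t : 0 <= \prod_(j <- iota 0 d) t j.
  by apply: prodr_ge0 => j _; exact: expR_ge0.
have rev_sum (f : nat -> R) : \sum_(j <- rev (iota 0 d)) f j = \sum_(j <- iota 0 d) f j.
  by apply: perm_big; rewrite perm_rev.
have rev_prod (f : nat -> R) : \prod_(j <- rev (iota 0 d)) f j = \prod_(j <- iota 0 d) f j.
  by apply: perm_big; rewrite perm_rev.
have appA : rc_approx (\sum_(j <- iota 0 d) r) (\prod_(j <- iota 0 d) t j)
    (\big[mulmx/1%:M]_(j <- iota 0 d) bigtensmx (fun i => (A i j)^T)).
  apply: (rc_approx_prod (r := fun=> r)) => j /in_iota jd; first exact: expR_ge0.
  by rewrite bigtensmx_tr; apply/rc_approx_tr/level.
have appB : rc_approx (\sum_(j <- iota 0 d) r) (\prod_(j <- iota 0 d) t j)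
    (\big[mulmx/1%:M]_(j <- rev (iota 0 d)) bigtensmx (fun i => B i j)).
  rewrite -rev_sum -rev_prod.
  apply: (rc_approx_prod (r := fun=> r)) => j; first by rewrite expR_ge0.
  by rewrite mem_rev => /in_iota; apply: level.
have sum_r : \sum_(j <- iota 0 d) r = d%:R * r.
  by rewrite big_const_seq count_predT size_iota iter_addr_0 mulr_natl.
apply: rc_approx_le
  (rc_approx_mul ler01 _ (rc_approx_bigtensmx_perm R F s)
     (rc_approx_mul prod_t prod_t appA appB)) _ _; first exact: mulr_ge0.
  by rewrite sum_r le_eqVlt; apply/orP; left; apply/eqP; rewrite /r; ring.
rewrite mul1r -expR_sum -expRD ler_expR -mulr2n -[X in X <= _]mulr_natl.
rewrite ler_pM2l // big_split /= lerD //; last first.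
  rewrite big_const_seq count_predT size_iota iter_addr_0 -[X in X <= _]mulr_natl.
  by rewrite le_eqVlt; apply/orP; left; apply/eqP; ring.
rewrite -mulr_suml ler_wpM2r // -mulr_sumr -mulr_sumr.
have -> : 12 * b * k%:R * Num.sqrt d%:R = 2 * (3 * b * k%:R * (2 * Num.sqrt d%:R)).
  by ring.
by rewrite ler_pM2l // ler_wpM2l ?sum_invsqrt_le // !mulr_ge0 // ltW.
Qed.

(** Row and column counts are integers, so a real bound [t] on them can be truncated. *)
Lemma rc_rigidity_le_approx (R : realType) (F : fieldType) (n : nat)
    (A : 'M[F]_n) (r : {nonneg R}) (t : R) :
  0 <= t -> rc_approx r%:num t A -> (rc_rigidity A r)%:R <= t.
Proof.
move=> t_ge0 [Z [rZ tZ tZ']].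
have /andP[tr_le tr_gt] := truncn_itv t_ge0.
apply: le_trans tr_le; rewrite ler_nat /rc_rigidity.
case: ex_minnP => m _; apply; apply/asboolP; exists Z; split => //.
have card_le (P : pred 'I_n) :
    \sum_x (P x)%:R <= t -> (#|[set x | P x]%SET| <= Num.truncn t)%N.
  move=> Pt; rewrite -ltnS -(ltr_nat R); apply: le_lt_trans tr_gt.
  apply: le_trans Pt; rewrite -sum1_card natr_sum big_mkcond /=.
  by apply: ler_sum => x _; rewrite inE; case: (P x).
by split=> [x|y]; apply: card_le.
Qed.

(** * Choice of parameters *)

(** The quadratic bound at [1/2] reads [exp (1/2) <= 1 + 1/2 + 1/2]. *)
Lemma ln2_ge_half (R : realType) : 2^-1 <= ln 2 :> R.
Proof.
rewrite -[X in X <= _]expRK ler_ln ?posrE ?expR_gt0 //.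
by apply: le_trans (expR_le_quadratic (lexx _)) _; lra.
Qed.

Lemma ln_prod_bounds (R : realType) (k d : nat) (ds : 'I_k -> nat) :
  (forall i, (2 <= ds i <= d)%N) ->
  k%:R * ln 2 <= ln ((\prod_(i < k) ds i)%N%:R : R) <= k%:R * ln d%:R.
Proof.
move=> ds_bd.
have lo : (2 ^ k <= \prod_(i < k) ds i)%N.
  rewrite -[X in (_ ^ X <= _)%N](card_ord k) -prod_nat_const; apply: leq_prod => i _.
  by case/andP: (ds_bd i).
have hi : (\prod_(i < k) ds i <= d ^ k)%N.
  rewrite -[X in (_ <= _ ^ X)%N](card_ord k) -prod_nat_const; apply: leq_prod => i _.
  by case/andP: (ds_bd i).
have n_gt0 : (0 < \prod_(i < k) ds i)%N by apply: leq_trans lo; rewrite expn_gt0.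
have dk_gt0 : (0 < d ^ k)%N by apply: leq_trans hi.
apply/andP; split.
  rewrite mulr_natl -lnXn // ler_ln ?posrE ?exprn_gt0 ?ltr0n //.
  by rewrite -natrX ler_nat.
case: d => [|d] in ds_bd hi dk_gt0 *.
  case: k ds ds_bd {hi lo n_gt0 dk_gt0} => [|k] ds ds_bd.
    by rewrite big_ord0 ln1 mul0r.
  by have /andP[h1 h2] := ds_bd ord0; have := leq_trans h1 h2.
rewrite mulr_natl -lnXn ?ltr0n // ler_ln ?posrE ?exprn_gt0 ?ltr0n //.
by rewrite -natrX ler_nat.
Qed.

Theorem theorem5p4 (R : realType) :
  exists2 c : R, 0 < c &
  forall (d : nat) (eps : R), (2 <= d)%N -> 0 < eps -> eps < 1 ->
  exists2 gamma : R,
    c * (eps ^+ 2 /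
         (d%:R `^ (3 / 2) * ln d%:R * ln (d%:R / eps) ^+ 2)) <= gamma &
    forall (F : fieldType) (k : nat) (ds : 'I_k -> nat)
           (M : forall i : 'I_k, 'M[F]_(ds i)),
      (forall i : 'I_k, (2 <= ds i <= d)%N) ->
      let n := (\prod_(i < k) ds i)%N in
      d%:R `^ (1 / gamma) <= n%:R :> R ->
      (rc_rigidity (bigtensmx M) (n%:R `^ (1 - gamma))%:nng)%:R
        <= n%:R `^ eps :> R.
Proof.
(* The constant stays abstract to keep [field] from expanding it. *)
have [q q_gt0 qE] : exists2 q : R, 0 < q & q = 480.
  by exists 480 => [|//]; rewrite ltr0n.
pose C : R := 5 * q ^+ 2.
have C_gt0 : 0 < C by rewrite mulr_gt0 ?exprn_gt0.
exists C^-1 => [|d eps d_ge2 eps_gt0 eps_lt1]; first by rewrite invr_gt0.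
have d2 : 2 <= d%:R :> R by rewrite ler_nat.
have d_gt0 : 0 < d%:R :> R by lra.
have ln_half : 2^-1 <= ln d%:R :> R.
  by apply: le_trans (ln2_ge_half R) _; rewrite ler_ln ?posrE.
have ln_gt0 : 0 < ln d%:R :> R by lra.
set Lam := ln (d%:R / eps).
have Lam_half : 2^-1 <= Lam.
  apply: le_trans ln_half _; rewrite ler_ln ?posrE ?divr_gt0 //.
  by rewrite ler_pdivlMr // ler_piMr // ltW.
have Lam_gt0 : 0 < Lam by lra.
set sd := Num.sqrt (d%:R : R).
have sd_gt0 : 0 < sd by rewrite sqrtr_gt0.
have sd2 : sd ^+ 2 = d%:R by rewrite sqr_sqrtr.
(* With [l = 5 Lam], the radius term [12 b k sd l] becomes [60 k eps / q], which [q = 480] makes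
   [k eps / 8]. *)
pose b := eps / (q * sd * Lam).
have b_gt0 : 0 < b by rewrite divr_gt0 ?mulr_gt0.
have bsd : b * sd = eps / (q * Lam).
  by rewrite /b; field; rewrite !gt_eqF.
(* Thus [b^2 k = 5 gamma k ln d >= 5 gamma L], where [L = ln n]. As [8 d <= d^4] and
   [ln d <= gamma L], the prefactor [8 d] uses up at most [4 gamma L] of this, leaving rank at most
   [n^(1 - gamma)]. *)
pose gamma := b ^+ 2 / (5 * ln d%:R).
have gammaE : gamma = C^-1 * (eps ^+ 2 / (d%:R * ln d%:R * Lam ^+ 2)).
  rewrite /gamma /b /C -sd2; field.
  by rewrite sd2 !gt_eqF.
have gamma_gt0 : 0 < gamma.
  by apply: divr_gt0; [exact: exprn_gt0 | exact: mulr_gt0].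
exists gamma.
  rewrite gammaE; apply: ler_wpM2l; first by rewrite invr_ge0 ltW.
  apply: ler_wpM2l; first exact: sqr_ge0.
  (* [gamma] has [d] where the required lower bound has the larger [d^(3/2)]. *)
  have pow_ge : d%:R <= d%:R `^ (3 / 2) :> R.
    rewrite -[X in X <= _](@powRr1 R) ?(ltW d_gt0) //; apply: ler_powR; lra.
  rewrite lef_pV2 ?posrE ?mulr_gt0 ?exprn_gt0 ?powR_gt0 //.
  by rewrite ler_pM2r ?exprn_gt0 // ler_pM2r.
move=> F k ds M ds_bd n.
have /andP[L_lo L_hi] := ln_prod_bounds R ds_bd; rewrite -/n in L_lo L_hi.
have n_gt0 : 0 < n%:R :> R.
  by rewrite ltr0n prodn_gt0 // => i; case/andP: (ds_bd i) => /ltnW.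
have powE (a x : R) : 0 < a -> a `^ x = expR (x * ln a).
  by move=> a_gt0; rewrite /powR gt_eqF.
rewrite powE // [n%:R `^ eps]powE //; set L := ln n%:R in L_lo L_hi *.
have nE : n%:R = expR L by rewrite lnK.
move=> n_ge; rewrite nE ler_expR in n_ge.
have k_ge0 : 0 <= k%:R :> R by [].
have ln_le : ln d%:R <= gamma * L.
  by move: n_ge; rewrite mul1r mulrC ler_pdivrMr // mulrC.
apply: rc_rigidity_le_approx; first exact: expR_ge0.
have ds_bd' i : (0 < ds i <= d)%N by case/andP: (ds_bd i) => /ltnW -> ->.
apply: rc_approx_le (rc_approx_bigtensmx M ds_bd' b_gt0 (l := 5 * Lam) _ _) _ _.
- rewrite -/sd bsd ler_pdivrMr ?mulr_gt0 // qE; lra.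
- by rewrite mulr_ge0 // ltW.
- rewrite /= powE // -/n -/L nE.
  have b2 : b ^+ 2 = 5 * gamma * ln d%:R.
    by rewrite /gamma; field; rewrite gt_eqF.
  have d4 : 8 * d%:R <= expR (4 * ln d%:R) :> R.
    rewrite expRM_natl lnK ?posrE // exprS mulrC ler_pM2l //.
    have -> : 8 = 2 ^+ 3 :> R by ring.
    by rewrite lerXn2r ?nnegrE // ltW.
  apply: le_trans (ler_wpM2r (expR_ge0 _) (ler_wpM2r (expR_ge0 _) d4)) _.
  rewrite -!expRD ler_expR b2.
  have : gamma * L <= gamma * (k%:R * ln d%:R) by rewrite ler_pM2l.
  have -> : gamma * (k%:R * ln d%:R) = gamma * ln d%:R * k%:R by ring.
  have -> : (1 - gamma) * L = L - gamma * L by ring.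
  lra.
rewrite ler_expR.
(* Here [e^(-l) = u^5] with [u = eps / d <= eps / 2], so the left side is
   [eps^2 u^3 <= eps^5 / 8]. *)
have ball : d%:R ^+ 2 * expR (- (5 * Lam)) <= eps / 8.
  have -> : - (5 * Lam) = 5%:R * (- Lam) by ring.
  rewrite expRM_natl expRN lnK ?posrE ?divr_gt0 // invf_div.
  set u := eps / d%:R.
  have du : d%:R * u = eps by rewrite /u mulrC divfK // gt_eqF.
  have u_gt0 : 0 < u by rewrite divr_gt0.
  have u_le : u <= eps / 2 by rewrite ler_pM2l // lef_pV2 ?posrE.
  have -> : d%:R ^+ 2 * u ^+ 5 = eps ^+ 2 * u ^+ 3 by rewrite -du; ring.
  apply: (@le_trans _ _ (eps ^+ 2 * (eps / 2) ^+ 3)).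
    rewrite ler_pM2l ?exprn_gt0 // lerXn2r ?nnegrE //; lra.
  have -> : eps ^+ 2 * (eps / 2) ^+ 3 = eps ^+ 5 / 8 by field.
  rewrite ler_pM2r ?invr_gt0 // exprS ler_piMr ?(ltW eps_gt0) //.
  by rewrite exprn_ile1 // ltW.
have e1 : 12 * b * k%:R * sd * (5 * Lam) = k%:R * (eps / 8).
  have -> : 12 * b * k%:R * sd * (5 * Lam) = 12 * (b * sd) * k%:R * (5 * Lam) by ring.
  by rewrite bsd qE; field; rewrite gt_eqF.
rewrite -/sd e1 -[_ * d%:R ^+ 2 * _]mulrA -mulrDr.
(* The two terms of size at most [k eps / 8], doubled, give
   [eps k / 2 <= eps k ln 2 <= eps ln n]. *)
apply: (@le_trans _ _ (eps * (k%:R * 2^-1))).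
  have -> : eps * (k%:R * 2^-1) = 2 * (k%:R * (eps / 8 + eps / 8)) by field.
  by rewrite ler_pM2l // ler_wpM2l // lerD2l.
rewrite ler_pM2l //; apply: le_trans L_lo; rewrite ler_wpM2l //.
exact: ln2_ge_half.
Qed.
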